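(* There is an effective procedure which, given a $\Pi^0_1$ set $S\subseteq\omega$ (via a c.e. index for its complement), produces fully primitive recursive permutations $\beta,\sigma,\tau$ of $\omega$ such that the group $G$ generated by $\beta,\sigma,\tau$ has word problem $\{w\in F(\beta,\sigma,\tau): w=1 \text{ in } G\}$ in the same truth-table degree as $S$.
   Context: A permutation $\pi$ of $\omega$ is fully primitive recursive if both $\pi$ and $\pi^{-1}$ are primitive recursive. $F(\beta,\sigma,\tau)$ is the free group on the symbols $\beta,\sigma,\tau$, with words coded by natural numbers; here the word problem of $G$ means the set of words evaluating to the identity permutation. Two sets have the same truth-table degree if each is truth-table reducible to the other. *)

(* Defs.v *)
From mathcomp Require Import all_boot.

Set Implicit Arguments.
Unset Strict Implicit.
Unset Printing Implicit Defensive.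

(** * Partial recursive functions (Kleene) *)

(** Arities are not tracked in the syntax: a definition is run on a list of
    arguments, and an argument that is missing from the list is read as 0.
    A k-ary function is (primitive) recursive in the usual sense iff some
    definition computes it on the lists of length k. *)
Inductive recdef : Type :=
| Zero
| Succ
| Proj of nat
| Comp of recdef & seq recdef
| Rec of recdef & recdef
| Mu of recdef.

Definition related_seqs (T U : Type) (R : T -> U -> Prop) :
    seq T -> seq U -> Prop :=
  fix loop s t :=
    match s, t with
    | [::], [::] => True
    | x :: s', y :: t' => R x y /\ loop s' t'
    | _, _ => False
    end.

(** [eval c xs y]: the computation of [c] on the arguments [xs] halts with
    value [y].  With [h := Rec f g], the recursion is on the first argument:
    [h (0, zs) = f zs] and [h (i+1, zs) = g (i, h (i, zs), zs)]; [t] lists the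
    successive values of [h].  [Mu f] at [zs] is the least [y] such that
    [f (y, zs) = 0], where [f (i, zs)] has to be defined for all [i <= y]. *)
Fixpoint eval (c : recdef) (xs : seq nat) (y : nat) : Prop :=
  match c with
  | Zero => y = 0
  | Succ => y = (head 0 xs).+1
  | Proj i => y = nth 0 xs i
  | Comp f gs =>
      exists2 zs, related_seqs (fun g z => eval g xs z) gs zs & eval f zs y
  | Rec f g =>
      exists t : nat -> nat,
        [/\ eval f (behead xs) (t 0),
            forall i, i < head 0 xs ->
              eval g [:: i, t i & behead xs] (t i.+1)
          & y = t (head 0 xs)]
  | Mu f =>
      eval f (y :: xs) 0 /\
      forall i, i < y -> exists v, eval f (i :: xs) v.+1
  end.

Fixpoint mu_free (c : recdef) : bool :=
  match c with
  | Zero | Succ | Proj _ => true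
  | Comp f gs => mu_free f && all mu_free gs
  | Rec f g => mu_free f && mu_free g
  | Mu _ => false
  end.

(** Goedel numbers; [CodeSeq.code] is a bijection from [seq nat] to [nat]. *)
Fixpoint recdef_code (c : recdef) : nat :=
  match c with
  | Zero => CodeSeq.code [:: 0]
  | Succ => CodeSeq.code [:: 1]
  | Proj i => CodeSeq.code [:: 2; i]
  | Comp f gs =>
      CodeSeq.code [:: 3; recdef_code f; CodeSeq.code (map recdef_code gs)]
  | Rec f g => CodeSeq.code [:: 4; recdef_code f; recdef_code g]
  | Mu f => CodeSeq.code [:: 5; recdef_code f]
  end.

Definition computable (f : nat -> nat) : Prop :=
  exists c, forall x, eval c [:: x] (f x).

Definition primrec_index (e : nat) (f : nat -> nat) : Prop :=
  exists c, [/\ recdef_code c = e, mu_free c & forall x, eval c [:: x] (f x)].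

(** The [e]-th c.e. set, the domain of the [e]-th partial recursive function
    (numbers that are not Goedel numbers index the nowhere defined one). *)
Definition W (e : nat) (x : nat) : Prop :=
  exists2 c, recdef_code c = e & exists y, eval c [:: x] y.

(** * Truth-table reducibility *)

(** Truth-table conditions on a set, as propositional formulas whose atoms are
    the membership queries. *)
Inductive ttcond : Type :=
| Query of nat
| Not of ttcond
| And of ttcond & ttcond
| Or of ttcond & ttcond.

Fixpoint ttcond_code (a : ttcond) : nat :=
  match a with
  | Query n => CodeSeq.code [:: 0; n]
  | Not a1 => CodeSeq.code [:: 1; ttcond_code a1]
  | And a1 a2 => CodeSeq.code [:: 2; ttcond_code a1; ttcond_code a2]
  | Or a1 a2 => CodeSeq.code [:: 3; ttcond_code a1; ttcond_code a2]
  end.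

Fixpoint satisfies (B : nat -> Prop) (a : ttcond) : Prop :=
  match a with
  | Query n => B n
  | Not a1 => ~ satisfies B a1
  | And a1 a2 => satisfies B a1 /\ satisfies B a2
  | Or a1 a2 => satisfies B a1 \/ satisfies B a2
  end.

Definition tt_reducible (A B : nat -> Prop) : Prop :=
  exists2 f : nat -> ttcond, computable (fun x => ttcond_code (f x)) &
    forall x, A x <-> satisfies B (f x).

Definition same_tt_degree (A B : nat -> Prop) : Prop :=
  tt_reducible A B /\ tt_reducible B A.

(** * Permutations of the natural numbers and words *)

Record natperm : Type := NatPerm {
  perm_fun :> nat -> nat;
  perm_inv : nat -> nat;
  perm_funK : cancel perm_fun perm_inv;
  perm_invK : cancel perm_inv perm_fun }.

(** [d] consists of primitive recursive indices for [p] and for its inverse. *)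
Definition fully_primrec_index (d : nat * nat) (p : natperm) : Prop :=
  primrec_index d.1 p /\ primrec_index d.2 (perm_inv p).

Inductive gen : Type := Beta | Sigma | Tau.

(** Words over the generators and their inverses, not necessarily reduced;
    [(g, false)] is the letter [g] and [(g, true)] is its inverse. *)
Definition word : Type := seq (gen * bool).

Definition letter_code (l : gen * bool) : nat :=
  (match l.1 with Beta => 0 | Sigma => 2 | Tau => 4 end) + l.2.

Definition word_code (w : word) : nat := CodeSeq.code (map letter_code w).

Definition letter_eval (p : gen -> natperm) (l : gen * bool) : nat -> nat :=
  if l.2 then perm_inv (p l.1) else p l.1.

(** The product of permutations is composition. *)
Definition word_eval (p : gen -> natperm) (w : word) : nat -> nat :=
  foldr (fun l f => letter_eval p l \o f) id w.

Definition word_problem (p : gen -> natperm) (n : nat) : Prop :=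
  exists2 w, word_code w = n & word_eval p w =1 id.

(* Main.v *)
(** The group acts on components, each a copy of Z x omega.  On all of them
    sigma is the shift along Z, beta swaps fibres 0 and 1 at position 0, and tau
    swaps fibres 3 and 4 at position 0.  On the component (x, s) tau also swaps
    fibres 1 and 2 at position x, provided that s certifies that the e-th
    machine halts on x (Kleene's T predicate, which is primitive recursive).
    The words beta and sigma^-x tau sigma^x then commute on every component,
    except on those (x, s) where s certifies halting on x: hence their
    commutator is 1 in G iff x is in S.  Conversely, whether a word is trivial
    on a component is decidable by inspecting a finite window, and if x exceeds
    twice the length of the word, no orbit segment sees both 0 and x, so that
    triviality with the swap at x follows from triviality without it.  Thus
    w = 1 iff w is trivial without these swaps and, for each x <= 2|w|, either
    trivial with the swap at x or x in S. *)
Require Import Defs.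
From mathcomp Require Import all_boot all_algebra zify.
Import CodeSeq.

Set Implicit Arguments.
Unset Strict Implicit.
Unset Printing Implicit Defensive.

(** * Primitive recursive functions *)

(** Only lists of length [k] matter, so a [k]-ary function is written as a function of a list, with
    arguments [nth 0 v i]. *)
Definition primrec (k : nat) (F : seq nat -> nat) : Prop :=
  exists2 c, mu_free c & forall v, size v = k -> eval c v (F v).

Lemma pr_ext k F G :
  (forall v, size v = k -> F v = G v) -> primrec k F -> primrec k G.
Proof. by move=> eqFG [c mc cF]; exists c => // v sv; rewrite -eqFG //; apply: cF. Qed.

Lemma pr_proj k i : primrec k (fun v => nth 0 v i).
Proof. by exists (Proj i). Qed.

Lemma pr_comp k m F (G : nat -> seq nat -> nat) :
  primrec m F -> (forall i, i < m -> primrec k (G i)) ->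
  primrec k (fun v => F (mkseq (G^~ v) m)).
Proof.
case=> cF mF evF prG.
have [cs mcs evs] : exists2 cs, all mu_free cs & forall v, size v = k ->
    related_seqs (fun g z => eval g v z) cs (mkseq (G^~ v) m).
  elim: m G prG {F cF mF evF} => [|m IHm] G prG; first by exists [::].
  have [//|c mc evc] := prG 0.
  have [i ltim|cs mcs evs] := IHm (fun i => G i.+1); first exact: prG.
  exists (c :: cs) => [|v sv]; first by rewrite /= mc.
  rewrite /mkseq /=; split; first exact: evc.
  by rewrite -(addn0 1) iotaDl -map_comp; apply: evs.
exists (Comp cF cs) => [|v sv]; first by rewrite /= mF.
exists (mkseq (G^~ v) m); first exact: evs.
by apply: evF; rewrite size_mkseq.
Qed.

Lemma pr_app1 k f a :
  primrec 1 (fun v => f (nth 0 v 0)) -> primrec k a -> primrec k (fun v => f (a v)).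
Proof. by move=> prf pra; apply: (@pr_comp _ _ _ (fun=> a)) prf _. Qed.

Lemma pr_app2 k f a b :
  primrec 2 (fun v => f (nth 0 v 0) (nth 0 v 1)) -> primrec k a -> primrec k b ->
  primrec k (fun v => f (a v) (b v)).
Proof.
move=> prf pra prb.
by apply: (@pr_comp _ _ _ (nth a [:: a; b])) prf _ => -[|[|]].
Qed.

Lemma pr_app3 k f a b c :
  primrec 3 (fun v => f (nth 0 v 0) (nth 0 v 1) (nth 0 v 2)) ->
  primrec k a -> primrec k b -> primrec k c -> primrec k (fun v => f (a v) (b v) (c v)).
Proof.
move=> prf pra prb prc.
by apply: (@pr_comp _ _ _ (nth a [:: a; b; c])) prf _ => -[|[|[|]]].
Qed.

Lemma pr_behead k F : primrec k F -> primrec k.+1 (fun v => F (behead v)).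
Proof.
move=> prF; apply: pr_ext (@pr_comp k.+1 k F (fun i v => nth 0 v i.+1) prF _).
  case=> //= x v [<-]; congr F; exact: mkseq_nth.
by move=> i _; apply: pr_proj.
Qed.

(** In the body of an iteration the arguments are the counter, the accumulator and the parameters;
    this serves bodies with a part that ignores the accumulator. *)
Lemma pr_skip2 k F :
  primrec k.+1 F -> primrec k.+2 (fun v => F (nth 0 v 0 :: behead (behead v))).
Proof.
move=> prF; pose G i := if i is j.+1 then fun v : seq nat => nth 0 v j.+2
                        else nth 0 ^~ 0.
apply: pr_ext (@pr_comp k.+2 k.+1 F G prF _).
  case=> [|x [|y v]] //= [<-]; congr F; rewrite /mkseq /= -(addn0 1) iotaDl.
  by rewrite -map_comp; congr cons; apply: mkseq_nth.
by case=> [|i] _; apply: pr_proj.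
Qed.

Lemma pr_S k a : primrec k a -> primrec k (fun v => (a v).+1).
Proof. by apply: (@pr_app1 _ S); exists Succ => // -[|x []]. Qed.

Lemma pr_const k n : primrec k (fun=> n).
Proof. by elim: n => [|n]; [exists Zero | apply: pr_S]. Qed.

Lemma pr_iteri k n a G :
  primrec k n -> primrec k a ->
  primrec k.+2 (fun v => G (nth 0 v 0) (nth 0 v 1) (behead (behead v))) ->
  primrec k (fun v => iteri (n v) (fun i z => G i z v) (a v)).
Proof.
move=> prn [ca ma eva] [cG mG evG].
(* [Rec] recurses on its first argument, so the counter is first made a separate argument; [n v] is
   substituted for it at the end. *)
pose H v := iteri (head 0 v) (fun i z => G i z (behead v)) (a (behead v)).
have prH : primrec k.+1 H.
  exists (Rec ca cG) => [|[|m v] //= [sv]]; first by rewrite /= ma.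
  exists (fun j => iteri j (fun i z => G i z v) (a v)); split=> //=.
    exact: eva.
  by move=> i _; apply: (evG [:: i, _ & v]); rewrite /= sv.
pose N i := if i is j.+1 then fun v : seq nat => nth 0 v j else n.
apply: pr_ext (@pr_comp k k.+1 H N prH _).
  move=> v sv; suff -> : mkseq (N^~ v) k.+1 = n v :: v by [].
  rewrite /mkseq /= -(addn0 1) iotaDl -map_comp -sv; congr cons.
  exact: mkseq_nth.
by case=> [|i] _ //; apply: pr_proj.
Qed.

(** * Arithmetic, tests and bounded quantifiers *)

Lemma pr_add k a b : primrec k a -> primrec k b -> primrec k (fun v => a v + b v).
Proof.
move=> pra prb; apply: (@pr_ext k (fun v => iteri (b v) (fun _ z => z.+1) (a v))).
  by move=> v _; elim: (b v) => [|n /= ->]; rewrite ?addn0 ?addnS.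
apply: (@pr_iteri k b a (fun _ z _ => z.+1)) => //; exact/pr_S/pr_proj.
Qed.

Lemma pr_mul k a b : primrec k a -> primrec k b -> primrec k (fun v => a v * b v).
Proof.
move=> pra prb.
apply: (@pr_ext k (fun v => iteri (b v) (fun _ z => z + a v) 0)).
  by move=> v _; elim: (b v) => [|n /= ->]; rewrite ?muln0 ?mulnSr.
apply: (@pr_iteri k b _ (fun _ z v => z + a v)) => //; first exact: pr_const.
by apply: pr_add; [apply: pr_proj | exact: pr_behead (pr_behead pra)].
Qed.

Lemma pr_exp k a b : primrec k a -> primrec k b -> primrec k (fun v => a v ^ b v).
Proof.
move=> pra prb.
apply: (@pr_ext k (fun v => iteri (b v) (fun _ z => z * a v) 1)).
  by move=> v _; elim: (b v) => [|n /= ->]; rewrite ?expn0 ?expnSr.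
apply: (@pr_iteri k b _ (fun _ z v => z * a v)) => //; first exact: pr_const.
by apply: pr_mul; [apply: pr_proj | exact: pr_behead (pr_behead pra)].
Qed.

Lemma pr_pred k a : primrec k a -> primrec k (fun v => (a v).-1).
Proof.
move=> pra; apply: (@pr_ext k (fun v => iteri (a v) (fun i _ => i) 0)).
  by move=> v _; case: (a v).
apply: (@pr_iteri k a _ (fun i _ _ => i)) => //; first exact: pr_const.
exact: pr_proj.
Qed.

Lemma pr_sub k a b : primrec k a -> primrec k b -> primrec k (fun v => a v - b v).
Proof.
move=> pra prb.
apply: (@pr_ext k (fun v => iteri (b v) (fun _ z => z.-1) (a v))).
  by move=> v _; elim: (b v) => [|n /= ->]; rewrite ?subn0 ?subnS.
apply: (@pr_iteri k b a (fun _ z _ => z.-1)) => //; exact/pr_pred/pr_proj.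
Qed.

Lemma pr_not k (a : seq nat -> bool) :
  primrec k (fun v => a v) -> primrec k (fun v => ~~ a v).
Proof.
move=> pra; apply: (@pr_ext k (fun v => 1 - a v)) => [v _|].
  by case: (a v).
by apply: pr_sub => //; apply: pr_const.
Qed.

Lemma pr_leq k a b : primrec k a -> primrec k b -> primrec k (fun v => a v <= b v).
Proof.
move=> pra prb; apply: (@pr_ext k (fun v => 1 - (a v - b v))) => [v _|].
  by rewrite /leq; case: (a v - b v) => // n; rewrite subSS sub0n.
by do ![apply: pr_sub | apply: pr_const].
Qed.

Lemma pr_and k (a b : seq nat -> bool) :
  primrec k (fun v => a v) -> primrec k (fun v => b v) -> primrec k (fun v => a v && b v).
Proof.
move=> pra prb; apply: pr_ext (pr_mul pra prb) => v _.
by case: (a v); case: (b v).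
Qed.

Lemma pr_or k (a b : seq nat -> bool) :
  primrec k (fun v => a v) -> primrec k (fun v => b v) -> primrec k (fun v => a v || b v).
Proof.
move=> pra prb; apply: pr_ext (pr_not (pr_and (pr_not pra) (pr_not prb))) => v _.
by case: (a v); case: (b v).
Qed.

Lemma pr_eq k a b : primrec k a -> primrec k b -> primrec k (fun v => a v == b v).
Proof.
move=> pra prb; apply: pr_ext (pr_and (pr_leq pra prb) (pr_leq prb pra)) => v _.
by rewrite eqn_leq.
Qed.

Lemma pr_if k (t : seq nat -> bool) a b :
  primrec k (fun v => t v) -> primrec k a -> primrec k b ->
  primrec k (fun v => if t v then a v else b v).
Proof.
move=> prt pra prb.
apply: (@pr_ext k (fun v => t v * a v + ~~ t v * b v)) => [v _|].
  by case: (t v); rewrite mul1n mul0n ?addn0.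
by do ![apply: pr_add | apply: pr_mul | apply: pr_not].
Qed.

Lemma pr_sum k n f :
  primrec k n -> primrec k.+1 (fun v => f (nth 0 v 0) (behead v)) ->
  primrec k (fun v => sumn [seq f i v | i <- iota 0 (n v)]).
Proof.
move=> prn prf.
apply: (@pr_ext k (fun v => iteri (n v) (fun i z => z + f i v) 0)) => [v _|].
  elim: (n v) => [//|m IHm].
  by rewrite -[in RHS]addn1 iotaD map_cat sumn_cat -IHm /= addn0.
apply: (@pr_iteri k n _ (fun i z v => z + f i v)) => //; first exact: pr_const.
by apply: pr_add; [apply: pr_proj | apply: pr_ext (pr_skip2 prf)].
Qed.

Lemma pr_has k n (f : nat -> seq nat -> bool) :
  primrec k n -> primrec k.+1 (fun v => f (nth 0 v 0) (behead v)) ->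
  primrec k (fun v => has (f^~ v) (iota 0 (n v))).
Proof.
move=> prn prf.
apply: pr_ext (pr_leq (pr_const k 1) (pr_sum prn prf)) => v _.
by rewrite has_count -sumn_count.
Qed.

Lemma pr_all k n (f : nat -> seq nat -> bool) :
  primrec k n -> primrec k.+1 (fun v => f (nth 0 v 0) (behead v)) ->
  primrec k (fun v => all (f^~ v) (iota 0 (n v))).
Proof.
move=> prn prf.
apply: pr_ext (pr_not (@pr_has _ _ (fun i v => ~~ f i v) prn _)) => [v _|].
  by rewrite -all_predC; congr nat_of_bool; apply: eq_all => i /=; rewrite negbK.
exact: pr_not.
Qed.

(** A hook at the end of [pr_step], redefined once the list operations are available. *)
Ltac pr_defined := fail.

Ltac pr_step :=
  lazymatch goal with
  | |- primrec _ (fun _ => ?c) => apply: pr_const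
  | |- primrec _ (fun v => nth 0 v _) => apply: pr_proj
  (* Under a bounded quantifier the outer variables become entries of [behead v], which are again
     projections. *)
  | |- primrec _ (fun v => nth 0 (behead _) _) =>
      eapply pr_ext; [intros; rewrite ?nth_behead; reflexivity | apply: pr_proj]
  | |- primrec _ (fun v => (@?a v).+1) => apply: (@pr_S _ a)
  | |- primrec _ (fun v => (@?a v).-1) => apply: (@pr_pred _ a)
  | |- primrec _ (fun v => @?a v + @?b v) => apply: (@pr_add _ a b)
  | |- primrec _ (fun v => @?a v - @?b v) => apply: (@pr_sub _ a b)
  | |- primrec _ (fun v => @?a v * @?b v) => apply: (@pr_mul _ a b)
  | |- primrec _ (fun v => @?a v ^ @?b v) => apply: (@pr_exp _ a b)
  | |- primrec _ (fun v => nat_of_bool (~~ @?a v)) => apply: (@pr_not _ a)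
  | |- primrec _ (fun v => nat_of_bool (@?a v && @?b v)) => apply: (@pr_and _ a b)
  | |- primrec _ (fun v => nat_of_bool (@?a v || @?b v)) => apply: (@pr_or _ a b)
  | |- primrec _ (fun v => nat_of_bool (@?a v <= @?b v)) => apply: (@pr_leq _ a b)
  | |- primrec _ (fun v => nat_of_bool (@?a v == @?b v)) => apply: (@pr_eq _ a b)
  | |- primrec _ (fun v => if _ then _ else _) => apply: pr_if
  | |- primrec _ (fun v => sumn (map (fun i => @?f v i) (iota 0 (@?n v)))) =>
      refine (@pr_sum _ n (fun i v => f v i) _ _)
  | |- primrec _ (fun v => nat_of_bool (has (fun i => @?f v i) (iota 0 (@?n v)))) =>
      refine (@pr_has _ n (fun i v => f v i) _ _)
  | |- primrec _ (fun v => nat_of_bool (all (fun i => @?f v i) (iota 0 (@?n v)))) =>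
      refine (@pr_all _ n (fun i v => f v i) _ _)
  | |- primrec _ (fun v => iteri (@?n v) (fun i z => @?f v i z) (@?a v)) =>
      refine (@pr_iteri _ n a (fun i z v => f v i z) _ _ _)
  | |- _ => pr_defined
  end.

Ltac prim_rec := repeat (cbv beta; pr_step).

(** * Operations on coded lists *)

Definition lcons (a l : nat) : nat := 2 ^ a * l.*2.+1.
Definition lhead (l : nat) : nat := head 0 (decode l).
Definition ltail (l : nat) : nat := code (behead (decode l)).
Definition lnth (l i : nat) : nat := nth 0 (decode l) i.
Definition ldrop (i l : nat) : nat := code (drop i (decode l)).
Definition lsize (l : nat) : nat := size (decode l).
Definition lmem (a l : nat) : bool := a \in decode l.

Lemma code_cons a s : code (a :: s) = lcons a (code s).
Proof. by []. Qed.

Lemma decode_lcons a l : decode (lcons a l) = a :: decode l.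
Proof. by rewrite -[l in LHS]decodeK -code_cons codeK. Qed.

Lemma lcons_inj a b k l : lcons a k = lcons b l -> a = b /\ k = l.
Proof.
by move/(congr1 decode); rewrite !decode_lcons => -[->];
   move/(can_inj decodeK) ->.
Qed.

Lemma lcons_gt a l : a < lcons a l /\ l < lcons a l.
Proof.
have a_lt : a < 2 ^ a by apply: ltn_expl.
rewrite /lcons; split; nia.
Qed.

Lemma lhead_lcons a l : lhead (lcons a l) = a.
Proof. by rewrite /lhead decode_lcons. Qed.

Lemma ltail_lcons a l : ltail (lcons a l) = l.
Proof. by rewrite /ltail decode_lcons /= decodeK. Qed.

Lemma lcons_lhead_ltail l : 0 < l -> lcons (lhead l) (ltail l) = l.
Proof.
rewrite -[l]decodeK; case: (decode l) => //= a s _.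
by rewrite /= -/(lcons _ _) lhead_lcons ltail_lcons.
Qed.

(** Sums stand in for bounded search: when only one term can be nonzero, the sum returns it. *)
Lemma sumn_iota1 n i f :
  i < n -> (forall j, j != i -> f j = 0) -> sumn [seq f j | j <- iota 0 n] = f i.
Proof.
move=> lt_in f0; rewrite sumnE big_map (bigD1_seq i) ?iota_uniq //=.
  by rewrite big1 ?addn0.
by rewrite mem_iota.
Qed.

Lemma pr_lcons k a b : primrec k a -> primrec k b -> primrec k (fun v => lcons (a v) (b v)).
Proof.
move=> pra prb; apply: (@pr_ext _ (fun v => 2 ^ a v * (b v + b v).+1)).
  by move=> v _; rewrite addnn.
by prim_rec.
Qed.

(** The head and tail of a nonempty list lie below its code, so both searches may stop at [l], and
    only the true head contributes to the sum. *)
Lemma pr_lhead k a : primrec k a -> primrec k (fun v => lhead (a v)).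
Proof.
apply: pr_app1; apply: (@pr_ext _ (fun v => let l := nth 0 v 0 in
  sumn [seq i * has (fun j => l == lcons i j) (iota 0 l) | i <- iota 0 l])).
  move=> v _ /=; set l := nth 0 v 0; case: (posnP l) => [-> // | l_gt0].
  have El := lcons_lhead_ltail l_gt0; have [lt_h lt_t] := lcons_gt (lhead l) (ltail l).
  rewrite El in lt_h lt_t.
  rewrite (sumn_iota1 (i := lhead l)) //.
    suff -> : has (fun j => l == lcons (lhead l) j) (iota 0 l) by rewrite muln1.
    by apply/hasP; exists (ltail l); rewrite ?mem_iota ?El.
  move=> i; case: hasP; rewrite ?muln0 // => -[j _ /eqP->].
  by rewrite lhead_lcons eqxx.
cbv zeta; prim_rec; apply: pr_lcons; prim_rec.
Qed.

Lemma pr_ltail k a : primrec k a -> primrec k (fun v => ltail (a v)).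
Proof.
apply: pr_app1; apply: (@pr_ext _ (fun v => let l := nth 0 v 0 in
  sumn [seq j * has (fun i => l == lcons i j) (iota 0 l) | j <- iota 0 l])).
  move=> v _ /=; set l := nth 0 v 0; case: (posnP l) => [-> // | l_gt0].
  have El := lcons_lhead_ltail l_gt0; have [lt_h lt_t] := lcons_gt (lhead l) (ltail l).
  rewrite El in lt_h lt_t.
  rewrite (sumn_iota1 (i := ltail l)) //.
    suff -> : has (fun i => l == lcons i (ltail l)) (iota 0 l) by rewrite muln1.
    by apply/hasP; exists (lhead l); rewrite ?mem_iota ?El.
  move=> j; case: hasP; rewrite ?muln0 // => -[i _ /eqP->].
  by rewrite ltail_lcons eqxx.
cbv zeta; prim_rec; apply: pr_lcons; prim_rec.
Qed.

Lemma ldrop_iteri i l : ldrop i l = iteri i (fun _ => ltail) l.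
Proof.
elim: i => [|i IHi] /=; first by rewrite /ldrop drop0 decodeK.
by rewrite -IHi /ltail /ldrop codeK -drop1 drop_drop add1n.
Qed.

Lemma pr_ldrop k a b : primrec k a -> primrec k b -> primrec k (fun v => ldrop (a v) (b v)).
Proof.
move=> pra prb; apply: (pr_ext (fun v _ => esym (ldrop_iteri (a v) (b v)))).
by apply: (@pr_iteri _ a b (fun _ z _ => ltail z)) => //; apply: pr_ltail; prim_rec.
Qed.

Lemma pr_lnth k a b : primrec k a -> primrec k b -> primrec k (fun v => lnth (a v) (b v)).
Proof.
move=> pra prb; apply: (pr_ext _ (pr_lhead (pr_ldrop prb pra))) => v _.
by rewrite /lhead /ldrop codeK /lnth -nth0 nth_drop addn0.
Qed.

Lemma lsize_leq l : lsize l <= l.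
Proof.
rewrite /lsize -[l in _ <= l]decodeK.
elim: (decode l) => //= a s IHs; rewrite -/(lcons _ _).
exact: leq_ltn_trans IHs (lcons_gt _ _).2.
Qed.

(** The length counts the [i] whose [i]-th tail is nonempty; it is at most the code, which bounds
    the search. *)
Lemma pr_lsize k a : primrec k a -> primrec k (fun v => lsize (a v)).
Proof.
apply: pr_app1; apply: (@pr_ext _ (fun v =>
  sumn [seq nat_of_bool (0 < ldrop i (nth 0 v 0)) | i <- iota 0 (nth 0 v 0)])).
  move=> v _; set l := nth 0 v 0.
  have pos i : (0 < ldrop i l) = (i < lsize l).
    rewrite -[i < _]subn_gt0 /lsize -size_drop /ldrop.
    by case: (drop _ _) => //= x s; rewrite muln_gt0 expn_gt0.
  rewrite (eq_map (g := fun i => nat_of_bool (i < lsize l))) => [|i]; last by rewrite pos.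
  have -> : iota 0 l = iota 0 (lsize l) ++ iota (0 + lsize l) (l - lsize l).
    by rewrite -iotaD subnKC ?lsize_leq.
  rewrite map_cat sumn_cat !sumn_count.
  rewrite (eq_in_count (a2 := predT)) => [|i]; last by rewrite mem_iota.
  rewrite count_predT size_iota (eq_in_count (a2 := pred0)) ?count_pred0 ?addn0 //.
  by move=> i; rewrite mem_iota => /andP[le_i _]; rewrite /= ltnNge le_i.
by prim_rec; apply: pr_ldrop; prim_rec.
Qed.

Lemma pr_lmem k a b : primrec k a -> primrec k b -> primrec k (fun v => lmem (a v) (b v)).
Proof.
apply: (@pr_app2 _ (fun a b => lmem a b)); apply: (@pr_ext _ (fun v =>
  has (fun i => lnth (nth 0 v 1) i == nth 0 v 0) (iota 0 (lsize (nth 0 v 1))))).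
  move=> v _; congr nat_of_bool; apply/hasP/(nthP 0) => [[i]|[i lt_i <-]].
    by rewrite mem_iota => lt_i /eqP <-; exists i.
  by exists i; rewrite ?mem_iota /lnth.
by prim_rec; [apply: pr_lsize | apply: pr_lnth]; prim_rec.
Qed.

Lemma pr_subst k F a :
  primrec k.+1 F -> primrec k.+1 a -> primrec k.+1 (fun v => F (a v :: behead v)).
Proof.
move=> prF pra; pose G i := if i is j.+1 then fun v : seq nat => nth 0 v i else a.
apply: pr_ext (@pr_comp k.+1 k.+1 F G prF _).
  case=> //= x v [<-]; congr F; rewrite /mkseq /= -(addn0 1) iotaDl -map_comp.
  by congr cons; apply: mkseq_nth.
by case=> [|i] _ //; apply: pr_proj.
Qed.

Lemma pr_lhas k l (f : nat -> seq nat -> bool) :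
  primrec k l -> primrec k.+1 (fun v => f (nth 0 v 0) (behead v)) ->
  primrec k (fun v => has (f^~ v) (decode (l v))).
Proof.
move=> prl prf; apply: (@pr_ext _ (fun v =>
  has (fun i => f (lnth (l v) i) v) (iota 0 (lsize (l v))))) => [v _|].
  by rewrite -[in RHS](mkseq_nth 0 (decode (l v))) has_map.
refine (@pr_has _ (fun v => lsize (l v)) (fun i v => f (lnth (l v) i) v) _ _).
  exact: pr_lsize.
apply: (pr_subst prf (a := fun v => lnth (l (behead v)) (nth 0 v 0))).
by apply: pr_lnth; [apply: pr_behead | apply: pr_proj].
Qed.

Lemma pr_lall k l (f : nat -> seq nat -> bool) :
  primrec k l -> primrec k.+1 (fun v => f (nth 0 v 0) (behead v)) ->
  primrec k (fun v => all (f^~ v) (decode (l v))).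
Proof.
move=> prl prf.
apply: pr_ext (pr_not (@pr_lhas _ _ (fun i v => ~~ f i v) prl _)) => [v _|].
  by rewrite -all_predC; congr nat_of_bool; apply: eq_all => i /=; rewrite negbK.
exact: pr_not.
Qed.

Ltac pr_defined ::=
  lazymatch goal with
  | |- primrec _ (fun v => lcons (@?a v) (@?b v)) => apply: (@pr_lcons _ a b)
  | |- primrec _ (fun v => lhead (@?a v)) => apply: (@pr_lhead _ a)
  | |- primrec _ (fun v => ltail (@?a v)) => apply: (@pr_ltail _ a)
  | |- primrec _ (fun v => ldrop (@?a v) (@?b v)) => apply: (@pr_ldrop _ a b)
  | |- primrec _ (fun v => lnth (@?a v) (@?b v)) => apply: (@pr_lnth _ a b)
  | |- primrec _ (fun v => lsize (@?a v)) => apply: (@pr_lsize _ a)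
  | |- primrec _ (fun v => nat_of_bool (lmem (@?a v) (@?b v))) =>
      apply: (@pr_lmem _ a b)
  | |- primrec _ (fun v => nat_of_bool
         (has (fun i => @?f v i) (decode (@?l v)))) =>
      refine (@pr_lhas _ l (fun i v => f v i) _ _)
  | |- primrec _ (fun v => nat_of_bool
         (all (fun i => @?f v i) (decode (@?l v)))) =>
      refine (@pr_lall _ l (fun i v => f v i) _ _)
  end.

(** * Kleene's T predicate *)

Notation L1 a := (lcons a 0).
Notation L2 a b := (lcons a (lcons b 0)).
Notation L3 a b c := (lcons a (lcons b (lcons c 0))).

(* A number coding [:: e] asserts that [e] is a Goedel number, and one coding
   [:: e; code xs; y] that the definition with number [e] maps [xs] to [y];
   it is justified by a list [R] of such assertions if it follows from members
   of [R] by one rule. *)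
Definition justified_code (e R : nat) : bool :=
  let p := lnth e 1 in
  let q := lnth e 2 in
  [|| e == L1 0, e == L1 1, e == L2 2 p,
      [&& e == L3 3 p q, lmem (L1 p) R &
          all (fun g => lmem (L1 g) R) (decode q)],
      [&& e == L3 4 p q, lmem (L1 p) R & lmem (L1 q) R]
    | (e == L2 5 p) && lmem (L1 p) R].

(** The intermediate values that [eval] quantifies over are found in members [b] of [R]: an argument
    list as [lnth b 1], an earlier value as [lnth b 2]. This keeps all quantifiers bounded. *)
Definition justified_value (e X y R : nat) : bool :=
  let p := lnth e 1 in
  let q := lnth e 2 in
  [|| (e == L1 0) && (y == 0), (e == L1 1) && (y == (lhead X).+1),
      (e == L2 2 p) && (y == lnth X p),
      (e == L3 3 p q) &&
        has (fun b => [&& b == L3 p (lnth b 1) y,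
               lsize (lnth b 1) == lsize q &
               all (fun i => lmem (L3 (lnth q i) X (lnth (lnth b 1) i)) R)
                 (iota 0 (lsize q))]) (decode R),
      [&& e == L3 4 p q, lhead X == 0 & lmem (L3 p (ltail X) y) R],
      [&& e == L3 4 p q, 0 < lhead X &
        has (fun b =>
               (b == L3 e (lcons (lhead X).-1 (ltail X)) (lnth b 2)) &&
               lmem (L3 q (lcons (lhead X).-1 (lcons (lnth b 2) (ltail X))) y) R)
          (decode R)]
    | [&& e == L2 5 p, lmem (L3 p (lcons y X) 0) R &
        all (fun i => has (fun b => (b == L3 p (lcons i X) (lnth b 2)) &&
                                    (0 < lnth b 2)) (decode R))
          (iota 0 y)]].

Definition justified (a R : nat) : bool :=
  let e := lnth a 0 in
  let X := lnth a 1 in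
  let y := lnth a 2 in
  (a == L1 e) && justified_code e R ||
  (a == L3 e X y) && justified_value e X y R.

(* Each entry is justified by the later ones. *)
Definition certificate (s : seq nat) : bool :=
  all (fun i => justified (nth 0 s i) (code (drop i.+1 s)))
    (iota 0 (size s)).

(** The assertion [L1 e] is required separately because a recursion at 0 is evaluated without
    looking at its step function, so a value alone does not make [e] a Goedel number. *)
Definition halts_by (e x t : nat) : bool :=
  [&& certificate (decode t), lmem (L1 e) t &
      has (fun a => a == L3 e (L1 x) (lnth a 2)) (decode t)].

Lemma pr_halts_by k a b c :
  primrec k a -> primrec k b -> primrec k c -> primrec k (fun v => halts_by (a v) (b v) (c v)).
Proof.
apply: (@pr_app3 _ (fun a b c => halts_by a b c)).
rewrite /halts_by; apply: pr_and; last by prim_rec.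
apply: (@pr_ext _ (fun v => all (fun i => justified (lnth (nth 0 v 2) i)
     (ldrop i.+1 (nth 0 v 2))) (iota 0 (lsize (nth 0 v 2))))) => //.
pr_step; first by prim_rec.
cbv beta; apply: (@pr_app2 _ (fun a b => justified a b)); [|by prim_rec..].
by rewrite /justified /justified_code /justified_value; cbv zeta; prim_rec.
Qed.

Lemma recdef_ind_nested (P : recdef -> Prop) :
  P Zero -> P Succ -> (forall i, P (Proj i)) ->
  (forall f gs, P f -> (forall i, i < size gs -> P (nth Zero gs i)) ->
    P (Comp f gs)) ->
  (forall f g, P f -> P g -> P (Rec f g)) ->
  (forall f, P f -> P (Mu f)) -> forall c, P c.
Proof.
move=> PZ PS Pp PC PR PM; fix IH 1; case=> [||i|f gs|f g|f].
- exact: PZ.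
- exact: PS.
- exact: Pp.
- apply: PC; first exact: IH.
  elim: gs => [|g gs IHgs] [|i]; [by []..| |].
    by move=> _; apply: IH.
  exact: IHgs.
- by apply: PR; apply: IH.
- by apply: PM; apply: IH.
Qed.

Lemma related_seqsP (T U : Type) (R : T -> U -> Prop) x y s t :
  related_seqs R s t <->
  size s = size t /\ forall i, i < size s -> R (nth x s i) (nth y t i).
Proof.
elim: s t => [|a s IHs] [|b t] /=; try by split=> // -[].
split=> [[Rab /IHs[-> Rst]]|[[est] Rst]].
  split; [by [] | by case=> [|i] //; apply: Rst].
by split; [apply: (Rst 0) | apply/IHs; split=> // i; apply: (Rst i.+1)].
Qed.

Lemma code_inj : injective code.
Proof. exact: can_inj codeK. Qed.

Lemma lnth_code s i : lnth (code s) i = nth 0 s i.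
Proof. by rewrite /lnth codeK. Qed.

Lemma lnth_lcons a l i : lnth (lcons a l) i = if i is j.+1 then lnth l j else a.
Proof. by rewrite /lnth decode_lcons; case: i. Qed.

Lemma recdef_codeE c :
  recdef_code c =
  match c with
  | Zero => L1 0
  | Succ => L1 1
  | Proj i => L2 2 i
  | Comp f gs => L3 3 (recdef_code f) (code (map recdef_code gs))
  | Rec f g => L3 4 (recdef_code f) (recdef_code g)
  | Mu f => L2 5 (recdef_code f)
  end.
Proof. by case: c. Qed.

(** * Soundness of certificates *)

(** A value assertion is constrained only when its first entry is a Goedel number; a number of
    neither form is true vacuously. *)
Definition true_fact (a : nat) : Prop :=
  (forall e, a = L1 e -> exists c, recdef_code c = e) /\
  (forall c xs y, a = L3 (recdef_code c) (code xs) y -> eval c xs y).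

Lemma lmem_fact (R : nat) a :
  (forall b, b \in decode R -> true_fact b) -> lmem a R -> true_fact a.
Proof. by move=> TR; apply: TR. Qed.

Lemma justified_code_sound e R :
  (forall b, b \in decode R -> true_fact b) ->
  justified_code e R -> exists c, recdef_code c = e.
Proof.
move=> TR; have valid g : lmem (L1 g) R -> exists c, recdef_code c = g.
  by case/(lmem_fact TR) => + _; apply.
case/or4P => [/eqP->|/eqP->|/eqP E|/or3P[]].
- by exists Zero.
- by exists Succ.
- by exists (Proj (lnth e 1)).
- case/and3P => /eqP E /valid[f Ef] vgs.
  suff [gs Egs] : exists gs, map recdef_code gs = decode (lnth e 2).
    by exists (Comp f gs); rewrite recdef_codeE Egs decodeK Ef.
  elim: (decode _) vgs => [|g s IHs] /=; first by exists [::].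
  by case/andP=> /valid[c <-] /IHs[gs <-]; exists (c :: gs).
- case/and3P => /eqP E /valid[f Ef] /valid[g Eg].
  by exists (Rec f g); rewrite recdef_codeE Ef Eg.
- by case/andP => /eqP E /valid[f Ef]; exists (Mu f); rewrite recdef_codeE Ef.
Qed.

(** The leading tag in each clause excludes all constructors of [c] but one; the clause then
    supplies the premises of the matching case of [eval]. *)
Lemma justified_value_sound c xs y R :
  (forall b, b \in decode R -> true_fact b) ->
  justified_value (recdef_code c) (code xs) y R -> eval c xs y.
Proof.
move=> TR; have val f zs z : lmem (L3 (recdef_code f) (code zs) z) R -> eval f zs z.
  by case/(lmem_fact TR) => _; apply.
rewrite /justified_value; cbv zeta.
rewrite [lhead (code xs)]/lhead [ltail (code xs)]/ltail codeK.
case/or4P => [/andP[/eqP E /eqP->]|/andP[/eqP E /eqP->]|/andP[/eqP E /eqP->]|].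
- by case: c E => [||i|f gs|f g|f]; rewrite recdef_codeE => /lcons_inj[].
- by case: c E => [||i|f gs|f g|f]; rewrite recdef_codeE => /lcons_inj[].
- case: c E => [||i|f gs|f g|f]; rewrite recdef_codeE => /lcons_inj[] //.
  by rewrite !lnth_lcons lnth_code.
case/or4P => [|||].
- case/andP=> /eqP; case: c => [||i|f gs|f g|f]; rewrite recdef_codeE => /lcons_inj[] // _ _.
  case/hasP => b bR; rewrite !lnth_lcons; set Z := lnth b 1.
  case/and3P => /eqP Eb /eqP sZ /allP vals.
  (* The assertion [b] about the outer function records the inner values as its argument list. *)
  exists (decode Z); last by apply: val; rewrite decodeK -Eb.
  have {}sZ : size gs = size (decode Z).
    by rewrite -/(lsize Z) sZ /lsize codeK size_map.
  apply/(related_seqsP _ Zero 0); split=> // i lt_i.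
  apply: val; rewrite -(nth_map _ 0) // -lnth_code; apply: vals.
  by rewrite mem_iota /lsize codeK size_map.
- case/and3P=> /eqP; case: c => [||i|f gs|f g|f]; rewrite recdef_codeE => /lcons_inj[] // _ _.
  rewrite !lnth_lcons => /eqP hd0 /val ev.
  by exists (fun=> y); rewrite hd0.
- case/and3P=> /eqP E; case: xs => // -[|m] xs // _ /hasP[b bR]; move: E.
  case: c => [||i|f gs|c1 c2|f]; rewrite recdef_codeE => /lcons_inj[] // _ _.
  rewrite !lnth_lcons /= => /andP[/eqP Eb evg].
  have {}evg := val c2 [:: m, lnth b 2 & xs] y evg.
  have /val[t [t0 tS Et]] : lmem (L3 (recdef_code (Rec c1 c2)) (code (m :: xs)) (lnth b 2)) R.
    by rewrite -[X in lmem X R]Eb.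
  (* The table certified for the argument [m] is extended by the value [y] at [m.+1]. *)
  exists (fun j => if j <= m then t j else y) => /=; split=> // [j|].
    rewrite ltnS => le_jm; rewrite le_jm; case: ltnP => [lt_jm|le_mj].
      exact: tS.
    have -> : j = m by apply/eqP; rewrite eqn_leq le_jm.
    by move: evg; rewrite Et.
  by rewrite ltnn.
- case/and3P=> /eqP; case: c => [||i|f gs|f g|f]; rewrite recdef_codeE => /lcons_inj[] // _ _.
  rewrite !lnth_lcons => /(val f (y :: xs)) ev0 /allP evS; split=> // i lt_iy.
  have /evS/hasP[b bR /andP[/eqP Eb pos]] : i \in iota 0 y by rewrite mem_iota.
  exists (lnth b 2).-1; apply: val; rewrite prednK // -/(code (i :: xs)) in Eb *.
  by rewrite /lmem -[code _]/(lcons i (code xs)) -Eb.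
Qed.

Lemma justified_sound a R :
  (forall b, b \in decode R -> true_fact b) -> justified a R -> true_fact a.
Proof.
move=> TR; case/orP=> /andP[/eqP Ea].
  move/(justified_code_sound TR) => cod; split.
    by move=> e Ee; move: cod; rewrite Ee lnth_lcons.
  by move=> c xs y Ea'; rewrite Ea' in Ea; case/lcons_inj: Ea => _ /(congr1 decode); rewrite decode_lcons.
move=> jv; split.
  by move=> e Ea'; rewrite Ea' in Ea; case/lcons_inj: Ea => _ /(congr1 decode); rewrite decode_lcons.
move=> c xs y Ea'; move: jv; rewrite Ea' !lnth_lcons.
exact: justified_value_sound.
Qed.

Lemma certificate_cons a s :
  certificate (a :: s) = justified a (code s) && certificate s.
Proof.
rewrite /certificate /= drop0; congr (_ && _).
by rewrite -(addn0 1) iotaDl all_map.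
Qed.

Lemma certificate_sound s a : certificate s -> a \in s -> true_fact a.
Proof.
elim: s a => // b s IHs a; rewrite certificate_cons => /andP[jb cs].
rewrite inE => /predU1P[->|]; last exact: IHs.
by apply: (justified_sound _ jb) => d; rewrite codeK; apply: IHs.
Qed.

(** * Completeness of certificates *)

Definition certified (a : nat) : Prop := exists2 s, certificate s & a \in s.

(** [R] occurs only positively in the rules, through membership and existence of members. *)
Lemma justified_subset a (s t : seq nat) :
  {subset s <= t} -> justified a (code s) -> justified a (code t).
Proof.
move=> st; have mem b : lmem b (code s) -> lmem b (code t).
  by rewrite /lmem !codeK; apply: st.
have hasS (P Q : pred nat) : {in s, forall b, P b -> Q b} ->
    has P (decode (code s)) -> has Q (decode (code t)).
  move=> PQ; rewrite !codeK => /hasP[b bs /(PQ b bs) Qb]; apply/hasP.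
  by exists b => //; apply: st.
rewrite /justified => /orP[] /andP[Ea J]; apply/orP; [left|right]; rewrite Ea.
  move: J; rewrite /justified_code; cbv zeta.
  case/or4P => [->|->|->|J]; rewrite ?orbT //; do 3![apply/orP; right].
  case/or3P: J => /andP[-> J]; apply/or3P; [apply: Or31|apply: Or32|apply: Or33].
  - case/andP: J => /mem-> J /=; apply: sub_all J => g; exact: mem.
  - by case/andP: J => /mem-> /mem->.
  - exact: mem.
move: J; rewrite /justified_value; cbv zeta.
case/or4P => [->|->|->|J]; rewrite ?orbT //; do 3![apply/orP; right].
case/or4P: J => /andP[-> J]; apply/or4P; [apply: Or41|apply: Or42|apply: Or43|apply: Or44].
- apply: hasS J => b _ /and3P[-> -> J] /=; apply: sub_all J => i; exact: mem.
- by case/andP: J => -> /mem->.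
- by case/andP: J => -> /=; apply: hasS => b _ /andP[-> /mem->].
case/andP: J => /mem-> J /=; apply: sub_all J => i.
by apply: hasS.
Qed.

Lemma certificate_cat s t : certificate s -> certificate t -> certificate (s ++ t).
Proof.
elim: s => // a s IHs; rewrite cat_cons !certificate_cons => /andP[ja cs] ct.
rewrite IHs // andbT; apply: justified_subset ja => b.
by rewrite mem_cat => ->.
Qed.

Lemma certified_all (s : seq nat) :
  (forall b, b \in s -> certified b) -> exists2 t, certificate t & {subset s <= t}.
Proof.
elim: s => [|b s IHs] cert; first by exists [::].
have [t ct st] := IHs (fun d ds => cert d (mem_behead (s := b :: s) ds)).
have [u cu bu] := cert b (mem_head _ _).
exists (u ++ t); first exact: certificate_cat.
by move=> d; rewrite inE mem_cat => /predU1P[->|/st->]; rewrite ?bu ?orbT.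
Qed.

(** The certificates of the premises are concatenated and the new assertion is put in front, where
    all of them justify it. *)
Lemma certified_step a s :
  (forall b, b \in s -> certified b) -> justified a (code s) -> certified a.
Proof.
move=> /certified_all[t ct st] ja; exists (a :: t); last exact: mem_head.
by rewrite certificate_cons ct (justified_subset st).
Qed.

Lemma justified_codeE e R : justified (L1 e) R = justified_code e R.
Proof.
rewrite /justified !lnth_lcons eqxx /=; case: eqP => [|_]; last by rewrite orbF.
by case/lcons_inj=> _ /(congr1 decode); rewrite decode_lcons.
Qed.

Lemma justified_valueE e X y R : justified (L3 e X y) R = justified_value e X y R.
Proof.
rewrite /justified !lnth_lcons eqxx /=; case: eqP => [|_] //.
by case/lcons_inj=> _ /(congr1 decode); rewrite decode_lcons.
Qed.

Lemma lmem_code a s : lmem a (code s) = (a \in s).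
Proof. by rewrite /lmem codeK. Qed.

Lemma lsize_code s : lsize (code s) = size s.
Proof. by rewrite /lsize codeK. Qed.

Lemma lhead_code s : lhead (code s) = head 0 s.
Proof. by rewrite /lhead codeK. Qed.

Lemma ltail_code s : ltail (code s) = code (behead s).
Proof. by rewrite /ltail codeK. Qed.

Lemma recdef_code_certified c : certified (L1 (recdef_code c)).
Proof.
elim/recdef_ind_nested: c => [||i|f gs Cf Cgs|f g Cf Cg|f Cf].
- by apply: (@certified_step _ [::]).
- by apply: (@certified_step _ [::]).
- apply: (@certified_step _ [::]) => //.
  by rewrite justified_codeE recdef_codeE /justified_code !lnth_lcons eqxx !orbT.
- apply: (@certified_step _ (L1 (recdef_code f) ::
      [seq L1 e | e <- map recdef_code gs])).
    move=> b; rewrite inE => /predU1P[->|/mapP[e + ->]] // => /(nthP 0)[i lt_i <-].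
    by rewrite size_map in lt_i; rewrite (nth_map Zero) //; apply: Cgs.
  rewrite justified_codeE recdef_codeE /justified_code !lnth_lcons eqxx.
  do 3![apply/orP; right]; apply/or3P; apply: Or31; rewrite andTb lmem_code mem_head.
  rewrite andTb codeK; apply/allP => g gs_g; rewrite lmem_code inE.
  by apply/orP; right; apply: map_f.
- apply: (@certified_step _ [:: L1 (recdef_code f); L1 (recdef_code g)]).
    by move=> b; rewrite !inE => /pred2P[]->.
  rewrite justified_codeE recdef_codeE /justified_code !lnth_lcons eqxx.
  by rewrite !lmem_code !inE !eqxx !orbT.
- apply: (@certified_step _ [:: L1 (recdef_code f)]).
    by move=> b; rewrite !inE => /eqP->.
  rewrite justified_codeE recdef_codeE /justified_code !lnth_lcons eqxx.
  by rewrite !lmem_code !inE !eqxx !orbT.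
Qed.

Lemma eval_certified c xs y :
  eval c xs y -> certified (L3 (recdef_code c) (code xs) y).
Proof.
elim/recdef_ind_nested: c xs y => [||i|f gs Cf Cgs|f g Cf Cg|f Cf] xs y.
- move=> ->; apply: (@certified_step _ [::]) => //.
  by rewrite justified_valueE recdef_codeE /justified_value !eqxx.
- move=> ->; apply: (@certified_step _ [::]) => //.
  by rewrite justified_valueE recdef_codeE /justified_value lhead_code !eqxx !orbT.
- move=> ->; apply: (@certified_step _ [::]) => //.
  rewrite justified_valueE recdef_codeE /justified_value !lnth_lcons lnth_code.
  by rewrite !eqxx !orbT.
- case=> zs /(related_seqsP _ Zero 0)[sz evs] evf.
  apply: (@certified_step _ (L3 (recdef_code f) (code zs) y ::
    mkseq (fun i => L3 (recdef_code (nth Zero gs i)) (code xs) (nth 0 zs i)) (size gs))).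
    move=> b; rewrite inE => /predU1P[->|/mapP[i]]; first exact: Cf.
    by rewrite mem_iota => lt_i ->; apply: Cgs => //; apply: evs.
  rewrite justified_valueE recdef_codeE /justified_value !lnth_lcons eqxx.
  do 3![apply/orP; right]; apply/or4P; apply: Or41; rewrite codeK /=.
  rewrite !lnth_lcons !lsize_code size_map sz !eqxx /=.
  apply/orP; left; apply/allP => i; rewrite mem_iota -sz => lt_i.
  rewrite -[2 ^ _ * _]/(code (_ :: _)) lmem_code inE; apply/orP; right.
  rewrite !lnth_code (nth_map Zero) //.
  by apply/mapP; exists i; rewrite ?mem_iota.
- case=> t [t0 tS ->].
  (* This covers a first argument 0 and also an empty argument list, whose missing first argument is
     read as 0. *)
  have base X : ltail X = code (behead xs) -> lhead X = 0 ->
      certified (L3 (recdef_code (Rec f g)) X (t 0)).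
    move=> Et Eh; apply: (@certified_step _ [:: L3 (recdef_code f) (code (behead xs)) (t 0)]).
      by move=> b; rewrite inE => /eqP->; apply: Cf.
    rewrite justified_valueE recdef_codeE /justified_value Et Eh !lnth_lcons.
    by rewrite lmem_code mem_head !eqxx !orbT.
  case: xs t0 tS base => [|m xs] /= t0 tS base; first exact: base.
  suff: forall i, i <= m -> certified (L3 (recdef_code (Rec f g)) (code (i :: xs)) (t i)).
    exact.
  elim=> [|i IHi] lt_im; first by apply: base; rewrite ?lhead_code ?ltail_code.
  apply: (@certified_step _ [:: L3 (recdef_code (Rec f g)) (code (i :: xs)) (t i);
     L3 (recdef_code g) (code [:: i, t i & xs]) (t i.+1)]).
    move=> b; rewrite !inE => /pred2P[]->; first exact/IHi/ltnW.
    exact/Cg/tS.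
  rewrite justified_valueE /justified_value lhead_code ltail_code.
  do 3![apply/orP; right]; apply/or4P; apply: Or43.
  move: (recdef_code (Rec f g)) (recdef_codeE (Rec f g)) => e Ee.
  have [Ep Eq] : lnth e 1 = recdef_code f /\ lnth e 2 = recdef_code g.
    by rewrite Ee !lnth_lcons.
  rewrite Ep Eq -Ee eqxx codeK; apply/orP; left.
  rewrite !lnth_lcons eqxx -[lcons _ (lcons (t i) _)]/(code [:: i, t i & xs]).
  by rewrite lmem_code !inE eqxx orbT.
- case=> ev0 evS.
  (* The positive values below [y] are gathered, by induction on [y], into one list of premises. *)
  have [s cs sP] : exists2 s : seq nat, (forall b, b \in s -> certified b) & forall i, i < y ->
      exists v, L3 (recdef_code f) (code (i :: xs)) v.+1 \in s.
    elim: y {ev0} evS => [|y IHy] evS; first by exists [::].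
    have [s cs sP] := IHy (fun i lt_iy => evS i (ltnW lt_iy)).
    have [v /Cf cv] := evS y (ltnSn y).
    exists (L3 (recdef_code f) (code (y :: xs)) v.+1 :: s).
      by move=> b; rewrite inE => /predU1P[->|/cs].
    move=> i; rewrite ltnS leq_eqVlt => /predU1P[->|/sP[w ws]].
      by exists v; rewrite mem_head.
    by exists w; rewrite inE ws orbT.
  apply: (@certified_step _ (L3 (recdef_code f) (code (y :: xs)) 0 :: s)).
    by move=> b; rewrite inE => /predU1P[->|/cs] //; apply: Cf.
  rewrite justified_valueE recdef_codeE /justified_value !lnth_lcons eqxx.
  do 3![apply/orP; right]; apply/or4P; apply: Or44.
  rewrite lmem_code mem_head andTb codeK.
  apply/allP => i; rewrite mem_iota => /sP[v vs]; apply/hasP.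
  exists (L3 (recdef_code f) (code (i :: xs)) v.+1); first by rewrite inE vs orbT.
  by rewrite !lnth_lcons eqxx.
Qed.

(** Kleene's normal form, from soundness and completeness of certificates. *)
Lemma W_halts_by e x : W e x <-> exists t, halts_by e x t.
Proof.
split=> [[c <- [y /eval_certified cy]]|[t /and3P[ct]]].
  have [b|t ct st] := @certified_all
      [:: L1 (recdef_code c); L3 (recdef_code c) (code [:: x]) y].
    by rewrite !inE => /pred2P[]-> //; apply: recdef_code_certified.
  exists (code t); rewrite /halts_by codeK ct lmem_code st ?mem_head //=.
  apply/hasP; exists (L3 (recdef_code c) (code [:: x]) y).
    by apply: st; rewrite !inE eqxx orbT.
  by rewrite !lnth_lcons -/(code [:: x]) eqxx.
rewrite /lmem => /(certificate_sound ct)[+ _] /hasP[a + /eqP Ea].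
move=> /(_ e erefl)[c Ec] /(certificate_sound ct)[_].
move=> /(_ c [:: x] (lnth a 2)); rewrite Ec => /(_ Ea) ev.
by exists c => //; exists (lnth a 2).
Qed.

(** * The action of words on a component *)

Definition swap (a b i : nat) : nat :=
  if i == a then b else if i == b then a else i.

(* A point (z, i) is position z : int on fibre i of one component.  Only tau
   depends on the component: its extra swap, at position x, is present iff b. *)
Definition step (x : nat) (b : bool) (l : gen * bool) (p : int * nat) : int * nat :=
  match l.1 with
  | Beta => (p.1, if p.1 == 0%R then swap 0 1 p.2 else p.2)
  | Sigma => ((if l.2 then p.1 - 1 else p.1 + 1)%R, p.2)
  | Tau => (p.1, let i := if p.1 == 0%R then swap 3 4 p.2 else p.2 in
                 if b && (p.1 == Posz x) then swap 1 2 i else i)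
  end.

(** * Displacement and locality of runs *)

Definition run x b (w : word) (p : int * nat) : int * nat := foldr (step x b) p w.

Definition trivial_on x b (w : word) : Prop := forall p, run x b w p = p.

(** The exponent sum of sigma. *)
Definition drift (w : word) : int :=
  foldr (fun l d => if l.1 is Sigma then (if l.2 then d - 1 else d + 1)%R else d)
    0%R w.

Lemma run_fst x b w p : (run x b w p).1 = (p.1 + drift w)%R.
Proof.
elim: w => [|l w IHw] /=; first by rewrite GRing.addr0.
by case: l => [[] []]; rewrite /step /= IHw; lia.
Qed.

Lemma drift_le w : absz (drift w) <= size w.
Proof. by elim: w => [|[[] []] w] //=; lia. Qed.

Lemma run_cons x b l w p : run x b (l :: w) p = step x b l (run x b w p).
Proof. by []. Qed.

(** Each letter moves the position by at most 1, so a word started farther than its length from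
    every active position meets no swap. *)
Lemma run_snd_off_sites x (b : bool) (w : word) (z : int) i :
  size w < absz z -> (b -> size w < absz (z - Posz x)%R) -> (run x b w (z, i)).2 = i.
Proof.
elim: w => //= l w IHw far0 farx; rewrite -/(run _ _ _ _).
have /= Ez := run_fst x b w (z, i); have lw := drift_le w.
have Ei : (run x b w (z, i)).2 = i by apply: IHw => [|/farx]; lia.
case: (run x b w (z, i)) Ei Ez => z' i' /= -> Ez.
have z0 : z' == 0%R = false by lia.
have zx : b && (z' == Posz x) = false by apply/negbTE/negP => /andP[/farx]; lia.
by case: l => [[] []]; rewrite /step /= ?z0 ?zx.
Qed.

Lemma run_high_fibre x b w z i : 5 <= i -> (run x b w (z, i)).2 = i.
Proof.
move=> i5; elim: w => //= l w; rewrite -/(run _ _ _ _).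
case: (run x b w (z, i)) => z' i' /= ->.
have fix_i m n : m < 5 -> n < 5 -> swap m n i = i.
  by move=> m5 n5; rewrite /swap !gtn_eqF // (leq_trans _ i5).
by case: l => [[] s]; rewrite /step /= ?fix_i ?if_same // fix_i ?if_same.
Qed.

Lemma run_far_from_x x (w : word) (z : int) i :
  size w < absz (z - Posz x)%R -> run x true w (z, i) = run 0 false w (z, i).
Proof.
elim: w => //= l w IHw farx; rewrite -!/(run _ _ _ _).
have /= Ez := run_fst 0 false w (z, i); have lw := drift_le w.
rewrite IHw; last by lia.
case: (run 0 false w (z, i)) Ez => z' i' /= Ez.
have zx : z' == Posz x = false by lia.
by case: l => [[] []]; rewrite /step /= ?zx.
Qed.

(* Away from position 0, tau at position x acts on the fibres 1 and 2
   as it does at position 0 on the fibres 3 and 4. *)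
Lemma run_far_from_0 x (w : word) (z : int) i :
  0 < x -> size w < absz z -> 0 < i < 3 ->
  0 < (run x true w (z, i)).2 < 3 /\
  run 0 false w (z - Posz x, i.+2)%R =
    ((run x true w (z, i)).1 - Posz x, (run x true w (z, i)).2.+2)%R.
Proof.
move=> x0; elim: w => //= l w IHw far0 i12; rewrite -!/(run _ _ _ _).
have /= Ez := run_fst x true w (z, i); have lw := drift_le w.
have [|//|j12 ->] := IHw; first by lia.
case: (run x true w (z, i)) Ez j12 => z' j /= Ez j12.
have z0 : z' == 0%R = false by lia.
have zx : (z' - Posz x == 0)%R = (z' == Posz x) by lia.
case: l => [[] []]; rewrite /step /= ?z0 ?zx ?j12; split=> //;
  try by case: ifP => // _; rewrite /swap; do ![case: ifP => //= ? | lia].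
- by congr pair; lia.
by congr pair; lia.
Qed.

Lemma run_off_0_outer_fibre x b (w : word) (z : int) i :
  size w < absz z -> ~~ (0 < i < 3) -> (run x b w (z, i)).2 = i.
Proof.
elim: w => //= l w IHw far0 i_out; rewrite -/(run _ _ _ _).
have Ei : (run x b w (z, i)).2 = i by apply: IHw => //; lia.
have /= Ez := run_fst x b w (z, i); have lw := drift_le w.
case: (run x b w (z, i)) Ei Ez => z' i' /= -> Ez.
have z0 : z' == 0%R = false by lia.
have fix_i : swap 1 2 i = i.
  by rewrite /swap; do ![case: eqP => ?]; lia.
by case: l => [[] []]; rewrite /step /= ?z0 ?fix_i ?if_same.
Qed.

(** As [x] exceeds twice the length, every start is farther than [size w] from [x] or from 0. In the
    first case the run agrees with the one without the extra swap; in the second its effect on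
    fibres 1 and 2 is a translated copy of a run on fibres 3 and 4 without that swap. *)
Lemma trivial_far x (w : word) :
  (size w).*2 < x -> trivial_on 0 false w -> trivial_on x true w.
Proof.
move=> x_gt triv [z i].
(* Triviality forces exponent sum 0 for sigma, so only the fibre remains to be controlled. *)
have d0 : drift w = 0%R.
  by have := run_fst 0 false w (0%R, 0); rewrite triv /= GRing.add0r.
have Ez := run_fst x true w (z, i); rewrite d0 GRing.addr0 in Ez.
have [le_wz|far0] := leqP (absz z) (size w).
  by rewrite run_far_from_x ?triv //; lia.
have Ei : (run x true w (z, i)).2 = i.
  have [i12|i_out] := boolP (0 < i < 3).
    have [|_] := run_far_from_0 _ far0 i12 (x := x); first by lia.
    by rewrite triv => -[].
  by apply: run_off_0_outer_fibre.
by rewrite [LHS]surjective_pairing Ez Ei.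
Qed.

(** Outside the window the word meets no swap, and fibres from 5 on are never moved; a point inside
    shows that the displacement is 0. *)
Lemma trivial_window x b (w : word) N :
  x + size w < N ->
  (forall (z : int) i, absz z <= N -> i < 5 -> run x b w (z, i) = (z, i)) ->
  trivial_on x b w.
Proof.
move=> ltN triv [z i].
have d0 : drift w = 0%R.
  by have := run_fst x b w (0%R, 0); rewrite triv //= GRing.add0r.
have Ez := run_fst x b w (z, i); rewrite d0 GRing.addr0 in Ez.
suff Ei : (run x b w (z, i)).2 = i by rewrite [LHS]surjective_pairing Ez Ei.
have [i5|] := ltnP i 5; last exact: run_high_fibre.
have [zN|Nz] := leqP (absz z) N; first by rewrite triv.
by apply: run_snd_off_sites => [|_]; lia.
Qed.

(** * The probe words *)

(** The rightmost letter acts first, so at position [z] this word permutes the fibres as tau does at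
    [z + x]. *)
Definition shifted_tau (x : nat) : word :=
  nseq x (Sigma, true) ++ (Tau, false) :: nseq x (Sigma, false).

(* [beta] and the conjugate of [tau] by [sigma ^ x] are involutions, so the
   square of their product is their commutator. *)
Definition probe (x : nat) : word :=
  (Beta, false) :: shifted_tau x ++ (Beta, false) :: shifted_tau x.

Lemma run_cat x b v w p : run x b (v ++ w) p = run x b v (run x b w p).
Proof. by rewrite /run foldr_cat. Qed.

Lemma run_shifted_tau y b x (z : int) i :
  run y b (shifted_tau x) (z, i) =
    (z, (step y b (Tau, false) ((z + Posz x)%R, i)).2).
Proof.
rewrite run_cat run_cons.
have up n : run y b (nseq n (Sigma, false)) (z, i) = ((z + Posz n)%R, i).
  elim: n => [|n IHn]; first by rewrite GRing.addr0.
  by rewrite [nseq _ _]/= run_cons IHn /step /=; congr pair; lia.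
have down n (u : int) j : run y b (nseq n (Sigma, true)) (u, j) = ((u - Posz n)%R, j).
  elim: n => [|n IHn]; first by rewrite GRing.subr0.
  by rewrite [nseq _ _]/= run_cons IHn /step /=; congr pair; lia.
by rewrite up [step _ _ _ _]surjective_pairing down /= GRing.addrK.
Qed.

(** At position 0 the factors involve the overlapping swaps of fibres 0, 1 and of fibres 1, 2; fibre
    0 is sent to fibre 2. *)
Lemma probe_nontrivial x : ~ trivial_on x true (probe x).
Proof.
move/(_ (0%R, 0)); rewrite /probe run_cons run_cat run_cons !run_shifted_tau.
by rewrite /step /= !GRing.add0r !eqxx; case: x.
Qed.

(** At position 0 the conjugate of tau is at most the swap of fibres 3 and 4, disjoint from that of
    beta, so the two involutions commute; elsewhere beta is idle and an involution is squared. *)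
Lemma probe_trivial (x y : nat) (b : bool) : (b -> y != x) -> trivial_on y b (probe x).
Proof.
move=> ne_yx [z i]; rewrite /probe run_cons run_cat run_cons !run_shifted_tau.
rewrite /step /=; have [z0|z0] /= := eqVneq z 0%R.
  rewrite z0 GRing.add0r.
  have -> : b && (Posz x == Posz y) = false.
    by apply/negbTE/negP => /andP[/ne_yx]; lia.
  by congr pair; case: (_ == 0%R); case: i => [|[|[|[|[|i]]]]].
congr pair; case: (_ == 0%R); case: (b && _);
  by case: i => [|[|[|[|[|i]]]]].
Qed.

(** * The permutations *)

Lemma pr_odd k a : primrec k a -> primrec k (fun v => odd (a v)).
Proof.
move=> pra.
apply: (@pr_ext _ (fun v => iteri (a v) (fun _ z => 1 - z) 0)); last by prim_rec.
by move=> v _; elim: (a v) => //= n ->; case: odd.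
Qed.

(** * Coding of pairs, integers and points *)

(** [lcons] is a bijection from pairs onto the positive numbers; the predecessor makes it one onto
    all numbers. *)
Definition pair_code (a b : nat) : nat := (lcons a b).-1.
Definition pair_fst (m : nat) : nat := lhead m.+1.
Definition pair_snd (m : nat) : nat := ltail m.+1.

Lemma pair_codeS a b : (pair_code a b).+1 = lcons a b.
Proof. by rewrite prednK // muln_gt0 expn_gt0. Qed.

Lemma pair_fstK a b : pair_fst (pair_code a b) = a.
Proof. by rewrite /pair_fst pair_codeS lhead_lcons. Qed.

Lemma pair_sndK a b : pair_snd (pair_code a b) = b.
Proof. by rewrite /pair_snd pair_codeS ltail_lcons. Qed.

Lemma pair_codeK m : pair_code (pair_fst m) (pair_snd m) = m.
Proof. by rewrite /pair_code lcons_lhead_ltail. Qed.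

Definition int_code (z : int) : nat :=
  match z with Posz n => n + n | Negz n => (n + n).+1 end.
Definition int_decode (n : nat) : int := if odd n then Negz n./2 else Posz n./2.

Lemma int_codeK : cancel int_code int_decode.
Proof.
case=> n; rewrite /int_decode /int_code addnn /= odd_double ?doubleK //=.
by rewrite uphalf_double.
Qed.

Lemma int_decodeK : cancel int_decode int_code.
Proof.
move=> n; rewrite /int_decode -[RHS]odd_double_half.
by case: odd; rewrite /= addnn.
Qed.

Lemma int_code0 z : (int_code z == 0) = (z == 0%R).
Proof. by case: z => -[]. Qed.

Lemma int_code_nat z n : (int_code z == n + n) = (z == Posz n).
Proof. by case: z => k /=; apply/eqP/eqP; lia. Qed.

(** Even codes are the nonnegative integers and odd codes the negative ones; the exceptional case
    takes the code 1 of -1 to the code 0. *)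
Definition code_up (n : nat) : nat :=
  if n == 1 then 0 else if odd n then n - 2 else n + 2.
Definition code_down (n : nat) : nat :=
  if n == 0 then 1 else if odd n then n + 2 else n - 2.

Lemma odd_addnn n : odd (n + n) = false.
Proof. by rewrite addnn odd_double. Qed.

Lemma int_code_up z : code_up (int_code z) = int_code (z + 1)%R.
Proof.
case: z => [n|[|n]] //; rewrite /code_up.
  rewrite (_ : (Posz n + 1)%R = Posz n.+1) /=; last by lia.
  by rewrite odd_addnn; case: eqP; lia.
rewrite (_ : (Negz n.+1 + 1)%R = Negz n) /=; last by lia.
by rewrite addnS /= odd_addnn /=; lia.
Qed.

Lemma int_code_down z : code_down (int_code z) = int_code (z - 1)%R.
Proof.
case: z => [[|n]|n] //; rewrite /code_down.
  rewrite (_ : (Posz n.+1 - 1)%R = Posz n) /=; last by lia.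
  by rewrite addnS /= odd_addnn /=; lia.
rewrite (_ : (Negz n - 1)%R = Negz n.+1) /=; last by lia.
by rewrite odd_addnn /=; lia.
Qed.

(* A component is named by (x, s); its extra swap is present iff
   [halts_by e x s]. *)
Definition point (p : int * nat) (x s : nat) : nat :=
  pair_code (int_code p.1) (pair_code p.2 (pair_code x s)).

Definition point_x (m : nat) : nat := pair_fst (pair_snd (pair_snd m)).
Definition point_s (m : nat) : nat := pair_snd (pair_snd (pair_snd m)).

Lemma point_xK p x s : point_x (point p x s) = x.
Proof. by rewrite /point_x !pair_sndK pair_fstK. Qed.

Lemma point_sK p x s : point_s (point p x s) = s.
Proof. by rewrite /point_s !pair_sndK. Qed.

Lemma pointP m : exists p x s, m = point p x s.
Proof.
exists (int_decode (pair_fst m), pair_fst (pair_snd m)), (point_x m), (point_s m).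
by rewrite /point int_decodeK !pair_codeK.
Qed.

Lemma point_inj p q x s : point p x s = point q x s -> p = q.
Proof.
case: p q => [z i] [u j] /(congr1 (fun m => (pair_fst m, pair_fst (pair_snd m)))).
by rewrite /point !pair_fstK !pair_sndK !pair_fstK => -[/(can_inj int_codeK)-> ->].
Qed.

(** [a] is a letter code and [b] a numerical truth value, so that coded words can be run as well;
    [a <= 1] covers beta and its inverse, the last branch tau and its inverse. *)
Definition step_code (a b m : nat) : nat :=
  let n := pair_fst m in
  let i := pair_fst (pair_snd m) in
  let r := pair_snd (pair_snd m) in
  let j := if n == 0 then swap 3 4 i else i in
  if a <= 1 then pair_code n (pair_code (if n == 0 then swap 0 1 i else i) r)
  else if a == 2 then pair_code (code_up n) (pair_code i r)
  else if a == 3 then pair_code (code_down n) (pair_code i r)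
  else pair_code n (pair_code
    (if (0 < b) && (n == point_x m + point_x m) then swap 1 2 j else j) r).

Lemma step_code_point (l : gen * bool) (b : bool) p x s :
  step_code (letter_code l) b (point p x s) = point (step x b l p) x s.
Proof.
rewrite /step_code point_xK {1 2 3 4 5 6 7 8 9 10 11 12 13 14}/point.
rewrite !pair_sndK !pair_fstK int_code0 int_code_nat int_code_up int_code_down.
by case: l => [[] []]; case: b.
Qed.

(** Beta and tau are involutions; for tau this uses that its two swaps commute, since both occur at
    position 0 when [x = 0]. *)
Lemma stepK x b g t p : step x b (g, ~~ t) (step x b (g, t) p) = p.
Proof.
have swapK m n : involutive (swap m n).
  move=> i; rewrite /swap; case: (eqVneq i m) => [->|im].
    by case: eqP => //; rewrite eqxx.
  by case: (eqVneq i n) => [->|iN]; rewrite ?eqxx // (negbTE im) (negbTE iN).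
have swapC i : swap 1 2 (swap 3 4 i) = swap 3 4 (swap 1 2 i).
  by case: i => [|[|[|[|[|i]]]]].
case: p => z i; case: g; rewrite /step /=.
- by case: (z == 0%R); rewrite ?swapK.
- by case: t; congr pair; lia.
by case: (z == 0%R); case: (b && _); rewrite ?swapC ?swapK.
Qed.

(** [e] stays an argument of a binary primitive recursive function, so that an index can later be
    computed from it. *)
Definition gen_code (l : gen * bool) (e m : nat) : nat :=
  step_code (letter_code l) (halts_by e (point_x m) (point_s m)) m.

Lemma gen_code_point l e p x s :
  gen_code l e (point p x s) = point (step x (halts_by e x s) l p) x s.
Proof. by rewrite /gen_code point_xK point_sK step_code_point. Qed.

Lemma gen_codeK e g t : cancel (gen_code (g, t) e) (gen_code (g, ~~ t) e).
Proof.
by move=> m; have [p [x [s ->]]] := pointP m; rewrite !gen_code_point stepK.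
Qed.

Definition gen_perm (e : nat) (g : gen) : natperm :=
  NatPerm (gen_codeK e g false) (gen_codeK e g true).

Lemma pr_step_code k a b c :
  primrec k a -> primrec k b -> primrec k c -> primrec k (fun v => step_code (a v) (b v) (c v)).
Proof.
apply: (@pr_app3 _ step_code).
rewrite /step_code /swap /code_up /code_down /point_x /pair_code /pair_fst.
by rewrite /pair_snd; cbv zeta; prim_rec; apply: pr_odd; prim_rec.
Qed.

Lemma pr_gen_code l : primrec 2 (fun v => gen_code l (nth 0 v 0) (nth 0 v 1)).
Proof.
apply: pr_step_code; [by prim_rec | apply: pr_halts_by | by prim_rec];
  by rewrite /point_x /point_s /pair_fst /pair_snd; prim_rec.
Qed.

Lemma word_eval_point e w p x s :
  word_eval (gen_perm e) w (point p x s) = point (run x (halts_by e x s) w p) x s.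
Proof.
elim: w => //= l w IHw; rewrite -/(word_eval _ w) IHw -gen_code_point.
by case: l => g [].
Qed.

Lemma word_eval_trivial e w :
  word_eval (gen_perm e) w =1 id <->
  trivial_on 0 false w /\ forall x, W e x -> trivial_on x true w.
Proof.
split=> [triv|[triv0 trivW] m].
  split=> [p|x /W_halts_by[s hx] p].
    (* 0 codes the empty list, which certifies nothing, so the component (0, 0) has no extra
       swap. *)
    by have := triv (point p 0 0); rewrite word_eval_point; apply: point_inj.
  by have := triv (point p x s); rewrite word_eval_point hx; apply: point_inj.
have [p [x [s ->]]] := pointP m; rewrite word_eval_point.
case hx: (halts_by e x s); first by rewrite trivW //; apply/W_halts_by; exists s.
suff -> : run x false w p = run 0 false w p by rewrite triv0.
by elim: w {triv0 trivW} => // -[[] []] w IHw; rewrite !run_cons IHw.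
Qed.

(** * The reductions *)

Lemma pr_computable f : primrec 1 (fun v => f (nth 0 v 0)) -> computable f.
Proof. by case=> c _ evc; exists c => x; apply: (evc [:: x]). Qed.

Definition const_def (n : nat) : recdef := iter n (fun c => Comp Succ [:: c]) Zero.

Lemma const_def_free n : mu_free (const_def n).
Proof. by elim: n => //= n ->. Qed.

Lemma eval_const_def n xs : eval (const_def n) xs n.
Proof. by elim: n => //= n IHn; exists [:: n]. Qed.

Lemma const_def_code n :
  recdef_code (const_def n) = iteri n (fun _ z => L3 3 (L1 1) (lcons z 0)) (L1 0).
Proof. by elim: n => // n IHn; rewrite /= -IHn. Qed.

(** The s-m-n construction: [e] is built in by composition with a definition of the constant [e],
    whose Goedel number is primitive recursive in [e]. *)
Lemma smn_index F :
  primrec 2 (fun v => F (nth 0 v 0) (nth 0 v 1)) ->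
  exists2 ix : nat -> nat, computable ix & forall e, primrec_index (ix e) (F e).
Proof.
case=> c mc evc; exists (fun e => recdef_code (Comp c [:: const_def e; Proj 0])).
  apply: pr_computable.
  apply: (@pr_ext _ (fun v => L3 3 (recdef_code c)
    (L2 (iteri (nth 0 v 0) (fun _ z => L3 3 (L1 1) (lcons z 0)) (L1 0)) (L2 2 0)))).
    by move=> v _; rewrite -const_def_code [RHS]recdef_codeE.
  by prim_rec.
move=> e; exists (Comp c [:: const_def e; Proj 0]); split=> //.
  by rewrite /= mc const_def_free.
move=> x; exists [:: e; x]; last exact: (evc [:: e; x]).
by split; [apply: eval_const_def | split].
Qed.

(** A single query suffices: the probe word for [x] is trivial iff [x] is outside [W e]. *)
Lemma S_tt_word_problem (S : nat -> Prop) e :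
  (forall x, S x <-> ~ W e x) -> tt_reducible S (word_problem (gen_perm e)).
Proof.
move=> SW; exists (fun x => Query (word_code (probe x))).
  apply: pr_computable.
  (* 3, 4 and 2 are the codes of the inverse of sigma, of tau and of sigma; [t] codes the rest of
     the word. *)
  pose shifted x t := iteri x (fun _ z => lcons 3 z)
    (lcons 4 (iteri x (fun _ z => lcons 2 z) t)).
  apply: (@pr_ext _ (fun v => L2 0 (lcons 0 (shifted (nth 0 v 0)
    (lcons 0 (shifted (nth 0 v 0) 0)))))); last by rewrite /shifted; prim_rec.
  move=> v _; move: (nth 0 v 0) => x.
  suff shiftedE w : shifted x (word_code w) = word_code (shifted_tau x ++ w).
    by rewrite /= -[lcons 0 (shifted x 0)]/(lcons 0 (shifted x (word_code [::])))
      shiftedE cats0 -[lcons 0 (word_code _)]/(word_code ((Beta, false) :: shifted_tau x)) shiftedE.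
  have rep l n u : word_code (nseq n l ++ u) =
      iteri n (fun _ z => lcons (letter_code l) z) (word_code u).
    by elim: n => //= n <-.
  have cons l u : word_code (l :: u) = lcons (letter_code l) (word_code u) by [].
  by rewrite /shifted_tau -catA rep cat_cons cons rep.
move=> x; split=> [Sx|[w wE triv]].
  exists (probe x) => //; apply/word_eval_trivial.
  split=> [|y Wy]; apply: probe_trivial => // _.
  by apply/eqP => Eyx; case/SW: Sx; rewrite -Eyx.
(* The word problem only provides some word with the given code; injectivity of the coding
   identifies it with the probe. *)
apply/SW => Wx; have {}wE : w = probe x.
  have letter_code_inj : injective letter_code by do 2!case=> [[] []].
  exact/(inj_map letter_code_inj)/code_inj.
by move: triv; rewrite wE => /word_eval_trivial[_ /(_ x Wx)]; apply: probe_nontrivial.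
Qed.

(** * Deciding triviality and the truth-table condition *)

(** The last letter acts first, so stage [j] reads the word from its end. *)
Definition run_code (b w m : nat) : nat :=
  iteri (lsize w) (fun j q => step_code (lnth w (lsize w - j.+1)) b q) m.

Lemma foldr_iteri (T : Type) (f : nat -> T -> T) z s :
  foldr f z s = iteri (size s) (fun j => f (nth 0 s (size s - j.+1))) z.
Proof.
elim: s => //= a s ->; rewrite subnn /=; congr f.
suff: forall m, m <= size s -> iteri m (fun j => f (nth 0 s (size s - j.+1))) z =
    iteri m (fun j => f (nth 0 (a :: s) ((size s).+1 - j.+1))) z by apply.
elim=> //= m IHm lt_m; rewrite IHm ?(ltnW lt_m) //; congr f.
by rewrite (_ : _.+1 - _ = (size s - m.+1).+1) //; lia.
Qed.

Lemma run_code_point (w : word) (b : bool) p x s :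
  run_code b (word_code w) (point p x s) = point (run x b w p) x s.
Proof.
rewrite /run_code /lsize /lnth codeK -(foldr_iteri (fun a => step_code a b)).
by elim: w => //= l w ->; rewrite step_code_point.
Qed.

(** For [N = x + lsize w + 1], integers of absolute value at most [N] have codes below [2N + 2]. As
    [b] is passed explicitly, 0 can serve as the last coordinate of the component. *)
Definition trivial_test (b x w : nat) : bool :=
  all (fun n => all (fun i =>
      run_code b w (pair_code n (pair_code i (pair_code x 0))) ==
      pair_code n (pair_code i (pair_code x 0))) (iota 0 5))
    (iota 0 ((x + lsize w).+1 + (x + lsize w).+1).+2).

Lemma trivial_testP (b : bool) x (w : word) :
  reflect (trivial_on x b w) (trivial_test b x (word_code w)).
Proof.
apply: (iffP allP) => [test|triv n _].
  apply: (@trivial_window _ _ _ (x + size w).+1) => // z i le_z i5.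
  have /test/allP/(_ i) : int_code z \in
      iota 0 ((x + lsize (word_code w)).+1 + (x + lsize (word_code w)).+1).+2.
    rewrite mem_iota lsize_code size_map.
    by case: z le_z => n /=; lia.
  rewrite mem_iota => /(_ i5) /eqP; rewrite -[pair_code (int_code z) _]/(point (z, i) x 0).
  by rewrite run_code_point => /point_inj.
apply/allP => i _; rewrite -[n]int_decodeK.
by rewrite -[pair_code (int_code _) _]/(point (int_decode n, i) x 0) run_code_point triv.
Qed.

Lemma pr_trivial_test k (b : bool) x w :
  primrec k x -> primrec k w -> primrec k (fun v => trivial_test b (x v) (w v)).
Proof.
apply: (@pr_app2 _ (fun x w => trivial_test b x w)).
rewrite /trivial_test /run_code /pair_code; prim_rec.
by apply: pr_step_code; prim_rec.
Qed.

(** Conditions have no constants, so falsity is a contradiction about one query. *)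
Definition cond_false : ttcond := And (Query 0) (Not (Query 0)).
Definition cond_true : ttcond := Not cond_false.

(** The queries are those [x], up to twice the length, at which the extra swap would make the word
    nontrivial. The initial condition tests that all entries are letter codes and that the word is
    trivial without extra swaps. *)
Definition word_cond (n : nat) : ttcond :=
  iteri (lsize n + lsize n).+1
    (fun x c => if trivial_test true x n then c else And (Query x) c)
    (if all (leq^~ 5) (decode n) && trivial_test false 0 n
     then cond_true else cond_false).

Lemma computable_word_cond : computable (fun n => ttcond_code (word_cond n)).
Proof.
apply: pr_computable; apply: (@pr_ext _ (fun v => let n := nth 0 v 0 in
  iteri (lsize n + lsize n).+1
    (fun x z => if trivial_test true x n then z else L3 2 (L2 0 x) z)
    (if all (fun a => a <= 5) (decode n) && trivial_test false 0 n
     then ttcond_code cond_true else ttcond_code cond_false))).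
  move=> v _; cbv zeta; move: (nth 0 v 0) => n; rewrite /word_cond.
  move: (_ && _) => b; elim: (lsize n + lsize n).+1 => [|m IHm]; first by case: b.
  by rewrite !iteriS IHm; case: ifP.
cbv zeta; prim_rec; apply: pr_trivial_test; prim_rec.
Qed.

Lemma satisfies_word_cond S n :
  satisfies S (word_cond n) <->
  [/\ all (leq^~ 5) (decode n), trivial_test false 0 n &
      forall x, x <= lsize n + lsize n -> trivial_test true x n \/ S x].
Proof.
rewrite /word_cond; set c0 := if _ then _ else _.
have -> m : satisfies S (iteri m
      (fun x c => if trivial_test true x n then c else And (Query x) c) c0) <->
    satisfies S c0 /\ forall x, x < m -> trivial_test true x n \/ S x.
  elim: m => [|m IHm]; first by split=> // -[].
  rewrite iteriS; split.
    case: ifP => [Tm /IHm[? Tlt]|_ [Sm /IHm[? Tlt]]]; split=> // x.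
      by rewrite ltnS leq_eqVlt => /predU1P[->|/Tlt//]; left.
    by rewrite ltnS leq_eqVlt => /predU1P[->|/Tlt//]; right.
  case=> Sc0 Tle; have Slt : satisfies S (iteri m
      (fun x c => if trivial_test true x n then c else And (Query x) c) c0).
    by apply/IHm; split=> // x lt_xm; apply: Tle; apply: ltnW.
  by case: ifP => // Tm; split=> //; case: (Tle m (ltnSn m)); rewrite ?Tm.
rewrite /c0; case: ifP => [/andP[le5 triv0]|no].
  by split=> [[_ Tle]|[_ _ Tle]]; split=> //= -[].
split=> [[[] //]|[le5 triv0]]; by rewrite le5 triv0 in no.
Qed.

Definition letter_decode (a : nat) : gen * bool :=
  (if a <= 1 then Beta else if a <= 3 then Sigma else Tau, odd a).

Lemma letter_decodeK a : a <= 5 -> letter_code (letter_decode a) = a.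
Proof. by case: a => [|[|[|[|[|[|]]]]]]. Qed.

Lemma word_problem_tt_S (S : nat -> Prop) e :
  (forall x, S x <-> ~ W e x) -> tt_reducible (word_problem (gen_perm e)) S.
Proof.
move=> SW; exists word_cond => [|n]; first exact: computable_word_cond.
rewrite satisfies_word_cond; split=> [[w <- /word_eval_trivial[triv0 trivW]]|].
  split; first by rewrite codeK; elim: w {triv0 trivW} => //= l w ->; case: l => [[] []].
    exact/trivial_testP.
  (* If the swap at [x] spoils triviality, then [x] is not in [W e], hence is in [S]. *)
  move=> x _; case: trivial_testP => triv; [by left | right].
  by apply/SW => /trivW.
case=> le5 triv0 trivx; have En : n = word_code (map letter_decode (decode n)).
  rewrite -[LHS]decodeK /word_code -map_comp; congr code.
  rewrite -[LHS]map_id; apply/eq_in_map => a /(allP le5) a5.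
  by rewrite /= letter_decodeK.
move: (map _ _) En => w En; rewrite {}En {n le5} in triv0 trivx *.
move/trivial_testP: triv0 => triv0.
exists w => //; apply/word_eval_trivial; split=> // x Wx.
(* Beyond twice the length no query is made: there triviality without the extra swap is enough. *)
have [le_x|gt_x] := leqP x (size w + size w); last first.
  by apply: trivial_far => //; rewrite -addnn.
case: (trivx x); first by rewrite lsize_code size_map.
  by move/trivial_testP.
by case/SW.
Qed.

Theorem theorem5p2 :
  exists d : gen -> nat -> nat * nat,
    (forall g : gen,
       computable (fun e => (d g e).1) /\ computable (fun e => (d g e).2)) /\
    forall (S : nat -> Prop) (e : nat),
      (forall x : nat, S x <-> ~ W e x) ->
      exists p : gen -> natperm,
        (forall g : gen, fully_primrec_index (d g e) (p g)) /\
        same_tt_degree (word_problem p) S.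
Proof.
have [ix ixP] : exists ix : gen * bool -> nat -> nat, forall l,
    computable (ix l) /\ forall e, primrec_index (ix l e) (gen_code l e).
  have ix l := smn_index (pr_gen_code l).
  (* Index functions exist letter by letter; the six of them are combined by cases, without
     choice. *)
  have [b0 ? ?] := ix (Beta, false); have [b1 ? ?] := ix (Beta, true).
  have [s0 ? ?] := ix (Sigma, false); have [s1 ? ?] := ix (Sigma, true).
  have [t0 ? ?] := ix (Tau, false); have [t1 ? ?] := ix (Tau, true).
  exists (fun l => match l with
    | (Beta, false) => b0 | (Beta, true) => b1
    | (Sigma, false) => s0 | (Sigma, true) => s1
    | (Tau, false) => t0 | (Tau, true) => t1 end).
  by case=> [[] []]; split.
exists (fun g e => (ix (g, false) e, ix (g, true) e)); split=> [g|S e SW].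
  by split; apply: (proj1 (ixP _)).
exists (gen_perm e); split=> [g|]; first by split; apply: (proj2 (ixP _)).
by split; [apply: word_problem_tt_S | apply: S_tt_word_problem].
Qed.
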